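(* Let $R$ be a ring and $M$ a right $R$-module, and consider the following conditions: (1) $\widehat{M}$ is an abelian endoregular module; (2) $M$ is polyform, every essentially closed submodule of $M$ is fully invariant in $M$, and $\operatorname{End}_R(M)$ is a reduced ring. Then (1) implies (2). Moreover, if $M$ is retractable, then (2) implies (1).
   Context: Rings are associative with identity and modules are unitary right modules. $E(M)$ is the injective hull of $M$, and $\widehat{M}=\operatorname{Hom}_R(M,E(M))M=\sum\{f(M)\mid f\in\operatorname{Hom}_R(M,E(M))\}\subseteq E(M)$ is the trace of $M$ in $E(M)$. A ring $S$ is von Neumann regular if for every $s\in S$ there is $x\in S$ with $sxs=s$; it is abelian if every idempotent is central; it is reduced if it has no nonzero nilpotent elements. A module is abelian endoregular if its endomorphism ring is abelian von Neumann regular. $M$ is polyform if for every submodule $K\leq M$ and every nonzero homomorphism $\varphi:K\to M$, $\operatorname{Ker}\varphi$ is not essential in $K$. A submodule $N$ of $M$ is essentially closed if whenever $N$ is essential in $L$ with $L\leq M$, then $L=N$. A submodule $N$ of $M$ is fully invariant if $\varphi(N)\subseteq N$ for all $\varphi\in\operatorname{End}_R(M)$. $M$ is retractable if $\operatorname{Hom}_R(M,N)\neq 0$ for each nonzero submodule $N$ of $M$. *)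

(* Defs.v *)
From HB Require Import structures.
From mathcomp Require Import all_boot all_order all_algebra.
From mathcomp Require Import boolp.

Set Implicit Arguments.
Unset Strict Implicit.
Unset Printing Implicit Defensive.

Import GRing.Theory.
Local Open Scope ring_scope.

(* A right R-module is a left module over the converse ring: x *: m is m.x *)
Notation rmodType R := (lmodType R^c).

Section RingProperties.
Variable S : pzRingType.

Definition von_neumann_regular := forall s : S, exists x : S, s * x * s = s.

Definition abelian_ring :=
  forall e : S, e * e = e -> forall x : S, e * x = x * e.

Definition reduced_ring := forall (x : S) (n : nat), x ^+ n = 0 -> x = 0.

End RingProperties.

(* The endomorphism ring, with composition (f * g) x = f (g x) as product. It is
   only a pzRingType because it is the zero ring when M = 0. *)
Definition End (R : pzRingType) (M : lmodType R) := {linear M -> M}.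

Section EndRing.
Variables (R : pzRingType) (M : lmodType R).
Implicit Types f g h : End M.

HB.instance Definition _ := gen_eqMixin (End M).
HB.instance Definition _ := gen_choiceMixin (End M).

Lemma End_ext f g : (forall x, f x = g x) -> f = g.
Proof.
move: f g => [f [[fa] [fs]]] [g [[ga] [gs]]] /= /funext fg.
case: _ / fg ga gs => ga gs.
by rewrite (Prop_irrelevance ga fa) (Prop_irrelevance gs fs).
Qed.

Definition End_zero : End M := \0 : {linear M -> M}.
Definition End_one : End M := idfun : {linear M -> M}.
Definition End_opp f : End M := \- (f : {linear M -> M}) : {linear M -> M}.
Definition End_add f g : End M :=
  (f : {linear M -> M}) \+ (g : {linear M -> M}) : {linear M -> M}.
Definition End_mul f g : End M :=
  (f : {linear M -> M}) \o (g : {linear M -> M}) : {linear M -> M}.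

Fact End_addA : associative End_add.
Proof. by move=> f g h; apply: End_ext => x /=; rewrite addrA. Qed.
Fact End_addC : commutative End_add.
Proof. by move=> f g; apply: End_ext => x /=; rewrite addrC. Qed.
Fact End_add0 : left_id End_zero End_add.
Proof. by move=> f; apply: End_ext => x /=; rewrite add0r. Qed.
Fact End_addN : left_inverse End_zero End_opp End_add.
Proof. by move=> f; apply: End_ext => x /=; rewrite addNr. Qed.

HB.instance Definition _ :=
  GRing.isZmodule.Build (End M) End_addA End_addC End_add0 End_addN.

Fact End_mulA : associative End_mul.
Proof. by move=> f g h; apply: End_ext. Qed.
Fact End_mul1l : left_id End_one End_mul.
Proof. by move=> f; apply: End_ext. Qed.
Fact End_mul1r : right_id End_one End_mul.
Proof. by move=> f; apply: End_ext. Qed.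
Fact End_mulDl : left_distributive End_mul +%R.
Proof. by move=> f g h; apply: End_ext. Qed.
Fact End_mulDr : right_distributive End_mul +%R.
Proof. by move=> f g h; apply: End_ext => x /=; rewrite raddfD. Qed.

HB.instance Definition _ := GRing.Zmodule_isPzRing.Build (End M)
  End_mulA End_mul1l End_mul1r End_mulDl End_mulDr.

End EndRing.

(* Submodules of M are the library's closed predicates K : submodClosed M;
   submod K is such a K regarded as a module in its own right. *)
Section SubmoduleType.
Variables (R : pzRingType) (M : lmodType R) (K : submodClosed M).

Definition submod := {x : M | x \in K}.

HB.instance Definition _ := SubChoice.on submod.

HB.instance Definition _ := [SubChoice_isSubLmodule of submod by <:].

End SubmoduleType.

Section Modules.
Variable R : pzRingType.

Definition lkernel (M N : lmodType R) (f : {linear M -> N}) : {pred M} :=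
  [pred x | f x == 0].

Definition limage (M N : lmodType R) (f : {linear M -> N}) : {pred N} :=
  [pred y | `[< exists x, f x = y >]].

(* N and L are meant to be submodules of M, predT being M itself. *)
Definition essential_in (M : lmodType R) (N L : {pred M}) : Prop :=
  {subset N <= L} /\
  forall X : submodClosed M, {subset X <= L} ->
    (forall x, x \in N -> x \in X -> x = 0) -> forall x, x \in X -> x = 0.

Definition essentially_closed (M : lmodType R) (N : submodClosed M) : Prop :=
  forall L : submodClosed M, essential_in N L -> L =i N.

Definition fully_invariant (M : lmodType R) (N : submodClosed M) : Prop :=
  forall (f : End M) (x : M), x \in N -> f x \in N.

Definition polyform (M : lmodType R) : Prop :=
  forall (K : submodClosed M) (f : {linear submod K -> M}),
    (exists x, f x <> 0) -> ~ essential_in (lkernel f) predT.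

Definition retractable (M : lmodType R) : Prop :=
  forall N : submodClosed M, (exists2 x, x \in N & x <> 0) ->
    exists (f : {linear M -> submod N}) (x : M), f x <> 0.

Definition abelian_endoregular (M : lmodType R) : Prop :=
  abelian_ring (End M) /\ von_neumann_regular (End M).

Definition injective_module (E : lmodType R) : Prop :=
  forall (A B : lmodType R) (j : {linear A -> B}) (f : {linear A -> E}),
    injective j -> exists g : {linear B -> E}, forall a, g (j a) = f a.

(* E together with i is an injective hull of M; hulls are unique up to
   isomorphism over M, so that the trace of M may be computed in any of them. *)
Definition injective_hull (M E : lmodType R) (i : {linear M -> E}) : Prop :=
  [/\ injective i, essential_in (limage i) predT & injective_module E].

End Modules.

Section Trace.
Variables (R : pzRingType) (M E : lmodType R).

(* The sum of the submodules f(M), for f in Hom(M, E), i.e. the set of finite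
   sums of elements of the f(M). *)
Definition trace : {pred E} := fun y =>
  `[< exists (n : nat) (f : 'I_n -> {linear M -> E}) (m : 'I_n -> M),
        y = \sum_(k < n) f k (m k) >].

Fact trace_submod_closed : GRing.submod_closed trace.
Proof.
split=> [|a u v /asboolP[n [f [x ->]]] /asboolP[p [g [y ->]]]]; apply/asboolP.
  by exists 0%N, (fun=> \0), (fun=> 0); rewrite big_ord0.
exists (n + p)%N, (fun k => match split k with inl l => f l | inr l => g l end),
  (fun k => match split k with inl l => a *: x l | inr l => y l end).
rewrite big_split_ord scaler_sumr /=; congr (_ + _); apply: eq_bigr => k _.
  by rewrite (unsplitK (inl k)) linearZ.
by rewrite (unsplitK (inr k)).
Qed.

HB.instance Definition _ :=
  GRing.isSubmodClosed.Build R E trace trace_submod_closed.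

Definition trace_module : lmodType R := submod trace.

End Trace.
Arguments trace {R} M E.
Arguments trace_module {R} M E.

(* Main.v *)
(** Write [Mhat] for the trace. It is quasi-injective, as a fully invariant submodule
    of the injective hull, and [M] is essential in it.

    (1) => (2): partial maps into [Mhat] extend to endomorphisms, whose kernels are
    cut out by central idempotents; polyformity, full invariance and reducedness are
    obtained by commuting these idempotents past suitable extensions.

    (2) => (1): polyformity says that an endomorphism of [Mhat] with essential kernel
    is zero. Inverting [g] on a complement of its kernel gives a quasi-inverse of [g]
    up to such an endomorphism. Centrality of an idempotent [e] amounts to the
    vanishing of the corners [e f (1 - e)], which follows from retractability and the
    full invariance of the closed submodules [M :&: Ker e] and [M :&: Im e]. *)

Require Import Defs.
From HB Require Import structures.
From mathcomp Require Import all_boot all_order all_algebra.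
From mathcomp Require Import boolp classical_sets.

Set Implicit Arguments.
Unset Strict Implicit.
Unset Printing Implicit Defensive.

Import GRing.Theory.
Local Open Scope ring_scope.

(** * Submodules, essential extensions and complements *)

Section Submodules.
Variable R : pzRingType.
Implicit Types U V W : lmodType R.

Lemma linear_pack U V (f : U -> V) :
  linear f -> exists g : {linear U -> V}, forall x, g x = f x.
Proof.
move=> lf; pose m := GRing.isLinear.Build R U V *:%R f lf.
pose g : {linear U -> V} := HB.pack f m.
by exists g.
Qed.

Lemma submod_pack V (P : V -> Prop) :
  P 0 -> (forall a u v, P u -> P v -> P (a *: u + v)) ->
  exists K : submodClosed V, forall x, x \in K <-> P x.
Proof.
move=> P0 PD; pose p : {pred V} := fun x => `[< P x >].
have cp : GRing.submod_closed p.
  split=> [|a u v /asboolP Pu /asboolP Pv]; apply/asboolP => //; exact: PD.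
pose m := GRing.isSubmodClosed.Build R V p cp.
pose K : submodClosed V := HB.pack p m.
by exists K => x; split=> /asboolP.
Qed.

Lemma cyclic_submod V (x : V) :
  exists K : submodClosed V, forall y, y \in K <-> exists a, y = a *: x.
Proof.
apply: submod_pack => [|a _ _ [b ->] [c ->]]; first by exists 0; rewrite scale0r.
by exists (a * b + c); rewrite scalerDl scalerA.
Qed.

(** Essentiality is tested against the cyclic submodule generated by [x]. *)
Lemma essential_scale V (N L : {pred V}) (x : V) :
  essential_in N L -> (forall a, a *: x \in L) -> x <> 0 ->
  exists2 a, a *: x \in N & a *: x <> 0.
Proof.
move=> [_ ess] Lx x0; have [K KP] := cyclic_submod x.
apply: contrapT => no; apply: x0.
apply: (ess K); last by apply/KP; exists 1; rewrite scale1r.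
  by move=> _ /KP[a ->].
move=> y Ny /KP[a yE]; apply: contrapT => y0; apply: no.
by exists a; rewrite -yE.
Qed.

Lemma scale_essential V (N L : {pred V}) :
  {subset N <= L} ->
  (forall x, x \in L -> x <> 0 -> exists2 a, a *: x \in N & a *: x <> 0) ->
  essential_in N L.
Proof.
move=> sNL ess; split=> // X sXL NX x Xx; apply: contrapT => x0.
have [a Na] := ess x (sXL x Xx) x0; apply; apply: NX => //; exact: rpredZ.
Qed.

Lemma linear_lift U V W (i : {linear V -> W}) (f : {linear U -> W}) :
  injective i -> (forall u, exists v, i v = f u) ->
  exists g : {linear U -> V}, forall u, i (g u) = f u.
Proof.
move=> inj_i /choice[g gP]; have [|h hE] := @linear_pack _ _ g.
  by move=> a u v; apply: inj_i; rewrite linearP !gP linearP.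
by exists h => u; rewrite hE.
Qed.

(** The kernel condition makes [f] factor through the image of [j], and injectivity of [W] extends
    the factor from that image to [V]. *)
Lemma injective_module_factor U V W (j : {linear U -> V}) (f : {linear U -> W}) :
  injective_module W -> (forall u, j u = 0 -> f u = 0) ->
  exists g : {linear V -> W}, forall u, g (j u) = f u.
Proof.
move=> injW ker_jf.
have [|a _ _ [u <-] [v <-]|K KP] := @submod_pack V (fun y => exists u, j u = y).
- by exists 0; rewrite linear0.
- by exists (a *: u + v); rewrite linearP.
have /choice[s sP] : forall y : submod K, exists u, j u = val y.
  by move=> y; apply/KP/valP.
have fE u v : j u = j v -> f u = f v.
  move=> juv; apply/eqP; rewrite -subr_eq0 -linearB; apply/eqP/ker_jf.
  by rewrite linearB juv subrr.
have [|h hE] := @linear_pack (submod K) W (f \o s).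
  by move=> a x y /=; rewrite -linearP; apply: fE; rewrite !(linearP, sP).
have [g gE] := injW _ _ (val : {linear submod K -> V}) h val_inj.
exists g => u; have Ku : j u \in K by apply/KP; exists u.
by rewrite -[j u]/(val (exist _ (j u) Ku : submod K)) gE hE /=; apply: fE; rewrite sP.
Qed.

(** Zorn's lemma gives a submodule maximal among those meeting [K] trivially. The second clause
    expresses that [K + C] is essential. *)
Lemma complement_submod V (K : submodClosed V) :
  exists2 C : submodClosed V, (forall x, x \in K -> x \in C -> x = 0)
    & forall x, x <> 0 -> exists a k c,
        [/\ a *: x <> 0, k \in K, c \in C & a *: x = k + c].
Proof.
(* [P] does not ask for [0] in [A], so that the union of the empty chain qualifies; maximality puts
   [0] back. *)
pose P (A : set V) := (forall a u v, A u -> A v -> A (a *: u + v)) /\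
  (forall x, x \in K -> A x -> x = 0).
have [|A [[AD AK] maxA]] := @Zorn_bigcup V P.
  move=> F FP Ftot; split=> [a u v [X FX Xu] [Y FY Yv]|x Kx [X FX Xx]].
    have [sXY|sYX] := Ftot _ _ FX FY.
      by exists Y => //; apply: (FP _ FY).1 => //; apply: sXY.
    by exists X => //; apply: (FP _ FX).1 => //; apply: sYX.
  exact: (FP _ FX).2 Kx Xx.
have A0 : A 0.
  apply: contrapT => nA0; apply: (maxA [set 0]%classic); last first.
    by split=> [a u v /= -> ->|x _ //]; rewrite scaler0 addr0.
  split=> [x Ax|/(_ 0 erefl) //]; case: nA0.
  by rewrite -(addNr x) -scaleN1r; apply: AD.
have [C CP] := submod_pack A0 AD.
exists C => [x Kx /CP|x x0]; first exact: AK.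
have [Ax|nAx] := pselect (A x).
  exists 1, 0, x; rewrite scale1r add0r; split=> //; [exact: rpred0|exact/CP].
(* By maximality of [A], the sum [B] of [A] and the multiples of [x] meets [K] in a nonzero
   [a *: x + c]; here [a *: x] is nonzero because [A] meets [K] trivially. *)
pose B : set V := fun y => exists a c, A c /\ y = a *: x + c.
have nPB : ~ P B.
  apply: maxA; split=> [y Ay|sBA]; first by exists 0, y; rewrite scale0r add0r.
  by apply: nAx; apply: sBA; exists 1, 0; rewrite scale1r addr0.
have [y Ky [[a [c [Ac yE]]] y0]] :
    exists2 y, y \in K & B y /\ y <> 0.
  apply: contrapT => no; apply: nPB; split.
    move=> b _ _ [a [c [Ac ->]]] [d [e [Ae ->]]]; exists (b * a + d), (b *: c + e).
    by split; [exact: AD|rewrite scalerDr scalerDl scalerA addrACA].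
  by move=> y Ky By; apply: contrapT => y0; apply: no; exists y.
exists a, y, (- c); split=> //; last by rewrite yE addrK.
  move=> ax0; move: yE y0; rewrite ax0 add0r => yE; apply; apply: AK => //.
  by rewrite yE.
by rewrite -scaleN1r; apply: rpredZ; apply/CP.
Qed.

End Submodules.

(** * Quasi-injectivity of the trace *)

Section HullTrace.
Variables (R : pzRingType) (M E : lmodType R) (i : {linear M -> E}).
Hypothesis hullE : injective_hull i.
Local Notation Mhat := (trace_module M E).

Lemma hull_scale (y : E) : y <> 0 -> exists a m, a *: y = i m /\ i m <> 0.
Proof.
have [_ ess _] := hullE => /(essential_scale ess) [//|a /asboolP[m mE] y0].
by exists a, m; rewrite mE.
Qed.

Lemma trace_corestrict (f : {linear M -> E}) :
  exists g : {linear M -> Mhat}, forall m, val (g m) = f m.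
Proof.
apply: (@linear_lift _ M Mhat E val) => [|m]; first exact: val_inj.
have fm : f m \in trace M E.
  by apply/asboolP; exists 1%N, (fun=> f), (fun=> m); rewrite big_ord1.
by exists (exist _ (f m) fm).
Qed.

Lemma trace_span (y : Mhat) :
  exists (n : nat) (f : 'I_n -> {linear M -> Mhat}) (m : 'I_n -> M),
    y = \sum_(k < n) f k (m k).
Proof.
have /asboolP[n [f [m yE]]] := valP y.
have /choice[g gE] := fun k => trace_corestrict (f k).
by exists n, g, m; apply: val_inj; rewrite yE raddf_sum; apply: eq_bigr => k _ /=; rewrite gE.
Qed.

Lemma trace_quasi_injective (U : lmodType R) (j f : {linear U -> Mhat}) :
  (forall u, j u = 0 -> f u = 0) ->
  exists h : End Mhat, forall u, h (j u) = f u.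
Proof.
have [_ _ injE] := hullE => ker_jf.
have [|g gE] := injective_module_factor (j := val \o j) (f := val \o f) injE.
  by move=> u /= ju0; rewrite ker_jf ?raddf0 //; apply: val_inj.
have [||h hE] := @linear_lift _ Mhat Mhat E val (g \o val); first exact: val_inj.
  (* The extension [g] to [E] preserves the trace, since composing a map from [M] with [g] gives a
     map from [M] again. *)
  move=> y; have [n [f' [m ->]]] := trace_span y.
  have /choice[g' gE'] := fun k => trace_corestrict (g \o val \o f' k).
  exists (\sum_(k < n) g' k (m k)); rewrite !raddf_sum.
  by apply: eq_bigr => k _ /=; rewrite gE'.
by exists h => u; apply: val_inj; rewrite hE /= gE.
Qed.

(** * The copy of [M] inside its trace *)

Section Inclusion.
Variable j : {linear M -> Mhat}.
Hypothesis jE : forall m, val (j m) = i m.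

Lemma incl_eq0 m : j m = 0 -> m = 0.
Proof.
have [inj_i _ _] := hullE => jm0; apply: inj_i.
by rewrite -jE jm0 !linear0.
Qed.

Lemma incl_inj : injective j.
Proof. by move=> x y /eqP; rewrite -subr_eq0 -linearB => /eqP/incl_eq0/subr0_eq. Qed.

Lemma incl_scale (y : Mhat) : y <> 0 -> exists a m, a *: y = j m /\ j m <> 0.
Proof.
move=> y0; have [|a [m [ayE m0]]] := @hull_scale (val y).
  by move=> vy0; apply: y0; apply: val_inj.
exists a, m; split; first by apply: val_inj; rewrite jE linearZ.
by move=> jm0; apply: m0; rewrite -jE jm0.
Qed.

Lemma extend_End (f : End M) : exists g : End Mhat, forall m, g (j m) = j (f m).
Proof.
by apply: (trace_quasi_injective (f := j \o f)) => m /incl_eq0 -> /=; rewrite !linear0.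
Qed.

(** * Consequences for [M] of the trace being abelian endoregular *)

Section AbelianRegular.
Hypothesis endo : abelian_endoregular Mhat.

(** If [g x g = g], then [e = x g] is an idempotent with the same kernel as [g], central because the
    ring is abelian. *)
Lemma central_idempotent (g : End Mhat) : exists x e : End Mhat,
  [/\ forall y, e y = x (g y), forall y, g (e y) = g y
    & forall (h : End Mhat) y, e (h y) = h (e y)].
Proof.
have [ab reg] := endo; have [x xE] := reg g; exists x, (x * g).
have ee : x * g * (x * g) = x * g by rewrite mulrA -(mulrA x g x) -mulrA xE.
split=> // [y|h y]; first by rewrite -[in RHS]xE.
exact: (congr1 (fun u : End Mhat => u y) (ab _ ee h)).
Qed.

Lemma polyform_of_endoregular : polyform M.
Proof.
move=> K f [k fk0] ess.
have [|g gE] := @trace_quasi_injective _ (j \o val) (j \o f).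
  move=> u /= /incl_eq0 u0; suff -> : u = 0 by rewrite !linear0.
  exact: val_inj.
have [x [e [eE ge eC]]] := central_idempotent g.
have e_ker u : e (j (val u)) = 0 -> f u = 0.
  by move=> eu0; apply: incl_eq0; rewrite -[j (f u)]gE -ge /= eu0 linear0.
have ker_e u : f u = 0 -> e (j (val u)) = 0.
  by move=> fu0; rewrite eE gE /= fu0 !linear0.
(* Since [Ker f] is essential in [K] and [e] kills its image, [1 - e] is injective on [j K]. So some
   [h] sends [y - e y] to [e y] for [y] in [j K], and [e y = e (h (y - e y)) = h (e (y - e y)) =
   0]. *)
pose je : {linear submod K -> Mhat} := (e : {linear Mhat -> Mhat}) \o j \o val.
pose jK : {linear submod K -> Mhat} := j \o val.
have [|h hE] := @trace_quasi_injective _ (jK \- je) je.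
  move=> u /= /subr0_eq ueu.
  suff -> : u = 0 by rewrite !linear0.
  apply: contrapT => u0; have [//|a] := essential_scale ess _ u0.
  rewrite inE => /eqP /ker_e; rewrite -[\val (a *: u)]/(a *: val u) !linearZ -ueu -linearZ.
  by move=> /incl_eq0 au0; apply; apply: val_inj.
apply: fk0; apply: e_ker.
have /= ejk := hE k.
have ee y : e (e y) = e y by rewrite [LHS]eE ge eE.
by rewrite -ee -[X in e X]ejk eC linearB ee subrr linear0.
Qed.

(** It suffices that [N] be essential in [L = N + f N]. If [X] in [L] meets [N] trivially, a central
    idempotent [e] kills [N] and fixes [X]; commuting with the extension of [f], it kills [L] too,
    so [X = 0]. *)
Lemma closed_fully_invariant_of_endoregular (N : submodClosed M) :
  essentially_closed N -> fully_invariant N.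
Proof.
move=> closedN f n Nn; have [g gE] := extend_End f.
have [||L LP] := @submod_pack _ M
  (fun x => exists u v, [/\ u \in N, v \in N & x = u + f v]).
- by exists 0, 0; rewrite rpred0 !linear0 addr0.
- move=> a _ _ [u [v [Nu Nv ->]]] [u' [v' [Nu' Nv' ->]]].
  exists (a *: u + u'), (a *: v + v').
  by split; rewrite ?rpredD ?rpredZ // linearP scalerDr addrACA.
rewrite -(closedN L); first by apply/LP; exists 0, n; rewrite rpred0 add0r.
split=> [u Nu|X sXL NX x Xx].
  by apply/LP; exists u, 0; rewrite rpred0 linear0 addr0.
(* As [N] and [X] meet trivially, the projection of [N + X] onto [X] is well defined and extends to
   [h]. *)
pose U : lmodType R := (submod N * submod X)%type.
pose jN : {linear U -> Mhat} := j \o val \o fst.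
pose jX : {linear U -> Mhat} := j \o val \o snd.
have [|h hE] := @trace_quasi_injective U (jN \+ jX) jX.
  move=> [[u Nu] [v Xv]]; rewrite /= -linearD => /incl_eq0 /= uv0.
  suff -> : v = 0 by rewrite linear0.
  apply: NX => //; rewrite -(addKr u v) uv0 addr0 -scaleN1r; exact: rpredZ.
have hN u : u \in N -> h (j u) = 0.
  by move=> Nu; have := hE (exist _ u Nu, 0); rewrite /= !linear0 addr0.
have hX v : v \in X -> h (j v) = j v.
  by move=> Xv; have := hE (0, exist _ v Xv); rewrite /= !linear0 add0r.
have [y [e [eE he eC]]] := central_idempotent h.
have eN u : u \in N -> e (j u) = 0 by move=> Nu; rewrite eE hN ?linear0.
have ex : e (j x) = j x by rewrite -[in LHS]hX // eC he hX.
have /LP[u [v [Nu Nv xE]]] := sXL x Xx.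
by apply: incl_eq0; rewrite -ex xE !linearD /= eN // add0r -gE eC eN ?linear0.
Qed.

Lemma reduced_of_endoregular : reduced_ring (End M).
Proof.
move=> f n fn0; have [g gE] := extend_End f.
have [x [e [eE ge eC]]] := central_idempotent g.
(* From [g y = g (e y) = e (g y) = x (g (g y))], the maps [f] and [f * f] have the same kernel. *)
have ker_f m : f (f m) = 0 -> f m = 0.
  move=> ffm0; apply: incl_eq0; rewrite -gE -ge -eC eE.
  by rewrite gE gE ffm0 !linear0.
(* Exponents are lowered one at a time; exponent [0] means [1 = 0], which forces [m = 0]. *)
apply: End_ext => m; elim: n {fn0}(congr1 (fun u : End M => u m) fn0) => [m0|n IH].
  by rewrite -[m]/((1 : End M) m) m0 linear0.
case: n IH => // n IH fm0; apply: IH; rewrite exprS; apply: ker_f.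
by move: fm0; rewrite !exprS.
Qed.

End AbelianRegular.

(** * Polyform [M]: essential kernels and von Neumann regularity *)

Section Polyform.
Hypothesis polyM : polyform M.

(** On the part [L] of [K] that [f] sends into [j M], [f] is a partial endomorphism of [M] with
    essential kernel. If [f x] were nonzero, a multiple of [x] would lie in [L] with nonzero
    image. *)
Lemma polyform_kernel (K : submodClosed M) (f : {linear M -> Mhat}) :
  (forall x, x \in K -> x <> 0 -> exists2 a, f (a *: x) = 0 & a *: x <> 0) ->
  forall x, x \in K -> f x = 0.
Proof.
move=> essf x Kx; apply: contrapT => fx0.
have [||L LP] := @submod_pack _ M (fun y => y \in K /\ exists m, j m = f y).
- by split; [exact: rpred0 | exists 0; rewrite !linear0].
- move=> a u v [Ku [m mE]] [Kv [p pE]]; split; first by rewrite rpredD ?rpredZ.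
  by exists (a *: m + p); rewrite !linearP mE pE.
have [|u|g gE] := @linear_lift _ (submod L) M Mhat j (f \o val).
- exact: incl_inj.
- by have /LP[_] := valP u.
apply: (@polyM L g); last first.
  apply: scale_essential => // u _ u0; have /LP[Ku _] := valP u.
  have [|a fa a0] := essf _ Ku; first by move=> vu0; apply: u0; apply: val_inj.
  exists a; last by move=> au0; apply: a0; rewrite -[LHS]/(val (a *: u)) au0.
  by rewrite inE; apply/eqP/incl_eq0; rewrite gE.
have [a [m [fE m0]]] := incl_scale fx0.
have Lx : a *: x \in L.
  by apply/LP; split; [exact: rpredZ | exists m; rewrite linearZ -fE].
pose z : submod L := exist _ (a *: x) Lx.
exists z => g0; apply: m0.
by rewrite -fE -linearZ -[a *: x]/(val z) -[LHS]gE g0 linear0.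
Qed.

Lemma polyform_kernelT (f : {linear M -> Mhat}) :
  (forall x, x <> 0 -> exists2 a, f (a *: x) = 0 & a *: x <> 0) ->
  forall x, f x = 0.
Proof.
move=> essf x; have [//|//|K KP] := @submod_pack _ M (fun=> True).
by apply: (@polyform_kernel K) => [y _|]; [exact: essf|apply/KP].
Qed.

(* Preimages of essential submodules are essential, and [Mhat] is spanned by the
   images of the maps from [M] to it. *)
Lemma trace_essential_kernel (t : End Mhat) :
  (forall y, y <> 0 -> exists2 a, t (a *: y) = 0 & a *: y <> 0) -> t = 0.
Proof.
move=> esst; apply: End_ext => y; have [n [f [m ->]]] := trace_span y.
rewrite linear_sum big1 // => k _.
apply: (@polyform_kernelT ((t : {linear Mhat -> Mhat}) \o f k)) => x x0 /=.
have [fx0|fx0] := pselect (f k x = 0).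
  by exists 1; rewrite scale1r // fx0 linear0.
have [a ta a0] := esst _ fx0; exists a; first by rewrite linearZ.
by move=> ax0; apply: a0; rewrite -linearZ ax0 linear0.
Qed.

Lemma regular_of_polyform : von_neumann_regular (End Mhat).
Proof.
move=> g; have [||K KP] := @submod_pack _ Mhat (fun y => g y = 0).
- exact: linear0.
- by move=> a u v gu gv; rewrite linearP gu gv scaler0 addr0.
have [C KC essC] := complement_submod K.
(* [g] is injective on [C], so some [h] inverts it there; [g * h * g - g] then kills the essential
   submodule [K + C]. *)
have [|h hE] := @trace_quasi_injective (submod C)
    ((g : {linear Mhat -> Mhat}) \o val) val.
  by move=> u /= /KP Ku; apply: (KC _ Ku); apply: valP.
exists h; apply/eqP; rewrite -subr_eq0; apply/eqP.
apply: trace_essential_kernel => y /essC[a [k [c [a0 /KP Kk Cc yE]]]].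
exists a => //; rewrite yE -[LHS]/(g (h (g (k + c))) - g (k + c)).
have /= hc := hE (exist _ c Cc).
by rewrite linearD Kk add0r hc subrr.
Qed.

(** If [N] is essential in [L], then [u] restricted to [L] has essential kernel, hence vanishes
    there, and [L] lies in [N]. *)
Lemma kernel_essentially_closed (u : End Mhat) (N : submodClosed M) :
  (forall m, m \in N <-> u (j m) = 0) -> essentially_closed N.
Proof.
move=> NP L essL x; apply/idP/idP => [Lx|]; last exact: essL.1.
apply/NP; apply: (@polyform_kernel L ((u : {linear Mhat -> Mhat}) \o j)) => // y Ly y0.
have [|a Na a0] := essential_scale essL _ y0; first by move=> a; apply: rpredZ.
by exists a => //; apply/NP.
Qed.

(** * Centrality of idempotents for retractable [M] *)

Section Abelian.
Hypothesis retrM : retractable M.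
Hypothesis closedM :
  forall N : submodClosed M, essentially_closed N -> fully_invariant N.

(* A nonzero [t] would be injective on some nonzero cyclic [Y] inside
   [N = M :&: Ker e] with [t Y] inside [N' = M :&: Im e]. Retracting [M] to [Y] by
   [p], full invariance makes [p] vanish on [N'] and [t p] vanish on [N], hence
   [p] vanishes on the essential submodule [N + N'] of [M]. *)
Lemma idempotent_corner0 (e f : End Mhat) : e * e = e -> e * f * (1 - e) = 0.
Proof.
move=> idem; have ee y : e (e y) = e y by rewrite -[in RHS]idem.
set t := e * f * (1 - e); apply: contrapT => t0.
have tE y : t y = e (f (y - e y)) by [].
have et y : e (t y) = t y by rewrite tE ee.
have te y : t (e y) = 0 by rewrite tE ee subrr !linear0.
have [||N NP] := @submod_pack _ M (fun m => e (j m) = 0).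
- by rewrite !linear0.
- by move=> a u v eu ev; rewrite !linearP eu ev scaler0 addr0.
have [||N' NP'] := @submod_pack _ M (fun m => (1 - e : End Mhat) (j m) = 0).
- by rewrite !linear0.
- by move=> a u v eu ev; rewrite !linearP eu ev scaler0 addr0.
have fiN := closedM (kernel_essentially_closed NP).
have fiN' := closedM (kernel_essentially_closed NP').
have N'E m : m \in N' <-> e (j m) = j m.
  split=> [/NP'/subr0_eq //|ejm]; apply/NP'; rewrite -[LHS]/(j m - e (j m)).
  by rewrite ejm subrr.
have NN' m : m \in N -> m \in N' -> m = 0.
  by move=> /NP em0 /N'E; rewrite em0 => /esym/incl_eq0.
(* Otherwise [t] has essential kernel on [N] and so vanishes there. Any [x] outside [Im e] has a
   multiple whose component along [1 - e] is a nonzero element of [j N], so [t] would have essential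
   kernel. *)
have [y [Ny y0 injy]] : exists y, [/\ y \in N, y <> 0
    & forall a, t (j (a *: y)) = 0 -> a *: y = 0].
  apply: contrapT => no.
  have tN m : m \in N -> t (j m) = 0.
    apply: (@polyform_kernel N ((t : {linear Mhat -> Mhat}) \o j)) => x Nx x0.
    apply: contrapT => nx; apply: no; exists x; split=> // a ta0.
    by apply: contrapT => ax0; apply: nx; exists a.
  apply: t0; apply: trace_essential_kernel => x x0.
  have [ex0|ex0] := pselect (x - e x = 0).
    by exists 1; rewrite scale1r // tE ex0 !linear0.
  have [a [m [aE m0]]] := incl_scale ex0; exists a; last first.
    by move=> ax0; apply: m0; rewrite -aE scalerBr -linearZ ax0 linear0 subrr.
  rewrite -[a *: x](subrK (a *: e x)) -scalerBr aE linearD -linearZ te addr0.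
  by apply: tN; apply/NP; rewrite -aE linearZ linearB ee subrr /= scaler0.
have [|b [m [bE m0]]] := @incl_scale (t (j y)).
  by move=> tjy0; apply: y0; rewrite -[y]scale1r; apply: injy; rewrite scale1r.
have [Y YP] := cyclic_submod (b *: y).
have tY x : x \in Y -> t (j x) = 0 -> x = 0.
  by move=> /YP[a ->]; rewrite scalerA; apply: injy.
have YN x : x \in Y -> x \in N by move=> /YP[a ->]; rewrite !rpredZ.
have [|p [x px0]] := retrM (N := Y).
  exists (b *: y); first by apply/YP; exists 1; rewrite scale1r.
  by move=> by0; apply: m0; rewrite -bE -!linearZ by0 !linear0.
have [q qE] : exists q : End M, forall z, q z = val (p z) by exists (val \o p).
have Yq z : q z \in Y by rewrite qE; apply: valP.
(* Scaling by [b] has placed [t (j Y)] inside [j M], so [t p] becomes an endomorphism [r] of [M], to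
   which full invariance of [N] applies. *)
have [|z|r rE] := @linear_lift _ M M Mhat j
  ((t : {linear Mhat -> Mhat}) \o j \o (q : {linear M -> M})).
- exact: incl_inj.
- have /YP[a qz] := Yq z; exists (a *: m).
  by rewrite linearZ -bE -[RHS]/(t (j (q z))) qz !linearZ.
apply: px0; apply: val_inj; apply: incl_eq0; rewrite -qE.
have qN' z : z \in N' -> q z = 0 by move=> N'z; apply: NN'; [exact: YN|exact: fiN'].
have qN z : z \in N -> q z = 0.
  move=> Nz; apply: tY => //; have /= <- := rE z.
  suff -> : r z = 0 by rewrite linear0.
  by apply: NN'; [exact: (fiN r)|apply/N'E; rewrite rE et].
apply: (@polyform_kernelT (j \o (q : {linear M -> M}))) => z z0.
have kill a v w : v \in N' -> w \in N -> a *: z = v + w -> (j \o q) (a *: z) = 0.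
  by move=> N'v Nw /= ->; rewrite linearD qN' // qN // addr0 linear0.
(* A nonzero multiple of [z] in [N + N']: [a] brings the component along [e] into [j M], then [c]
   does so for the one along [1 - e]. *)
have [ez0|ez0] := pselect (e (j z) = 0).
  exists 1; rewrite ?scale1r //= qN ?linear0 //; exact/NP.
have [a [v [aE v0]]] := incl_scale ez0.
have N'v : v \in N' by apply/N'E; rewrite -aE linearZ ee.
have az0 : a *: z <> 0 by move=> az0; apply: v0; rewrite -aE -!linearZ az0 !linear0.
have [ez1|ez1] := pselect (j (a *: z) - e (j (a *: z)) = 0).
  by exists a => //=; rewrite qN' ?linear0 //; apply/N'E/esym/subr0_eq.
have [c [w [cE w0]]] := incl_scale ez1.
exists (c * a); rewrite -scalerA; last first.
  by move=> cz0; apply: w0; rewrite -cE scalerBr -!linearZ cz0 !linear0 addr0.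
rewrite scalerA; apply: (kill _ (c *: v) w); first exact: rpredZ.
  by apply/NP; rewrite -cE linearZ linearB ee subrr /= scaler0.
apply: incl_inj; rewrite -scalerA linearD -cE [j (c *: v)]linearZ -aE /=.
have -> : a *: e (j z) = e (j (a *: z)) by rewrite !linearZ.
by rewrite -scalerDr addrC subrK linearZ.
Qed.

(** The vanishing corners at [e] and at [1 - e] give [e f = e f e = f e]. *)
Lemma abelian_of_retractable : abelian_ring (End Mhat).
Proof.
move=> e idem f.
have /subr0_eq : e * f - e * f * e = 0.
  by rewrite -[RHS](idempotent_corner0 f idem) mulrBr mulr1.
move=> ->.
have idem' : (1 - e) * (1 - e) = 1 - e.
  by rewrite mulrBl mul1r mulrBr mulr1 idem subrr subr0.
have := idempotent_corner0 f idem'.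
by rewrite subKr -mulrA mulrBl mul1r mulrA => /subr0_eq.
Qed.

End Abelian.
End Polyform.
End Inclusion.
End HullTrace.

Theorem theorem2p24 (R : pzRingType) (M E : rmodType R) (i : {linear M -> E})
    (hE : injective_hull i) :
  let cond1 := abelian_endoregular (trace_module M E) in
  let cond2 :=
    [/\ polyform M,
        (forall N : submodClosed M, essentially_closed N -> fully_invariant N)
      & reduced_ring (End M)] in
  (cond1 -> cond2) /\ (retractable M -> cond2 -> cond1).
Proof.
have [j jE] := trace_corestrict i; split=> [endo|retrM [polyM closedM _]].
  split.
  - exact (polyform_of_endoregular hE jE endo).
  - exact (closed_fully_invariant_of_endoregular hE jE endo).
  - exact (reduced_of_endoregular hE jE endo).
split; first exact (abelian_of_retractable hE jE polyM retrM closedM).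
exact (regular_of_polyform hE jE polyM).
Qed.
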